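(* Let $G$ be a finite simple graph and let $S\subseteq E(G)$. For every $t\ge 1$ let $G_t=G_t(S)$ and $H_t=H_t(S)$ be as defined in the context. Then for every fixed positive integer $k$, the sequences $\{\lambda_k(G_t)\}_{t\in\mathbb{N}}$ and $\{\lambda_k(H_t)\}_{t\in\mathbb{N}}$ are Cauchy sequences, and \[\lim_{t\to\infty}\lambda_k(G_t)=\lim_{t\to\infty}\lambda_k(H_t).\]
   Context: For a finite simple graph $F$ on $m$ vertices, $\lambda_1(F)\ge\lambda_2(F)\ge\cdots\ge\lambda_m(F)$ denote the eigenvalues of its adjacency matrix, and $|F|$ denotes its number of vertices. Given a graph $G$ and $S\subseteq E(G)$, for $t\ge1$ the graph $G_t(S)$ is obtained from $G$ by replacing each edge $uv\in S$ by a path $P_{uv}$ of length $t$ (i.e. $t$ edges, with $t-1$ new internal vertices) between $u$ and $v$; in particular $G_1(S)=G$ and $|G_t(S)|=|G|+(t-1)|S|$. The graph $H_t(S)$ is obtained from $G_{2t+1}(S)$ by deleting the middle edge of each path $P_{uv}$, $uv\in S$ (each such path has $2t+1$ edges, so it has a unique middle edge); thus $|H_t(S)|=|G|+2t|S|$. *)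

(* Defs.v *)
From HB Require Import structures.
From mathcomp Require Import all_boot all_order all_algebra.
From mathcomp Require Import polyrcf.
From mathcomp Require Import all_classical all_reals all_analysis.

Set Implicit Arguments.
Unset Strict Implicit.
Unset Printing Implicit Defensive.

Import Order.TTheory GRing.Theory Num.Theory.
Import numFieldNormedType.Exports.

Record sgraph := SGraph {
  svertex :> finType;
  sedge : rel svertex;
  sedge_sym : symmetric sedge;
  sedge_irr : irreflexive sedge }.

Definition edges (G : sgraph) : {set {set G}} :=
  [set [set p.1; p.2] | p : G * G & sedge p.1 p.2].

Section Eigenvalues.
Variable R : rcfType.
Local Open Scope ring_scope.

Definition adjacency (G : sgraph) : 'M[R]_#|G| :=
  \matrix_(i, j) (sedge (enum_val i) (enum_val j))%:R.

(* [rootsR p] lists each real root of [p] once, hence the repetition by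
   multiplicity; an adjacency matrix is symmetric, so that all the roots of
   its characteristic polynomial are real. *)
Definition spectrum n (A : 'M[R]_n) : seq R :=
  let p := char_poly A in
  sort >=%R (flatten [seq nseq (mup x p) x | x <- rootsR p]).

(* [k] counts from 1; the value is the dummy 0 when [k > #|G|]. *)
Definition lambda (k : nat) (G : sgraph) : R :=
  nth 0 (spectrum (adjacency G)) k.-1.

End Eigenvalues.

Section Subdivision.
Variables (G : sgraph) (S : {set {set G}}).

(* [inl v] is the vertex [v] of [G]; [inr (s, j)] is the internal vertex at
   distance [j.+1] from the start of the path that replaces the edge [s]. *)
Definition subdiv_vertex (t : nat) : finType :=
  (G + {s : {set G} | s \in S} * 'I_t.-1)%type.

(* [at_pos s i x]: [x] is the [i]-th vertex (0 <= i <= t) of the path of length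
   [t] replacing [s]. The path runs from the first to the second element of
   [enum s]; this orientation does not affect the graph up to isomorphism. *)
Definition at_pos (t : nat) (s : {s : {set G} | s \in S}) (i : nat)
    (x : subdiv_vertex t) : bool :=
  match x with
  | inl v => (i == 0) && (onth (enum (val s)) 0 == Some v)
             || (i == t) && (onth (enum (val s)) 1 == Some v)
  | inr (s', j) => (s' == s) && (i == j.+1)
  end.

Definition path_edge (t : nat) (s : {s : {set G} | s \in S}) (i : nat)
    (x y : subdiv_vertex t) : bool :=
  at_pos s i x && at_pos s i.+1 y || at_pos s i y && at_pos s i.+1 x.

Definition kept_edge (t : nat) (x y : subdiv_vertex t) : bool :=
  match x, y with
  | inl u, inl v => sedge u v && ([set u; v] \notin S)
  | _, _ => false
  end.

Definition subdiv_edge (t : nat) (x y : subdiv_vertex t) : bool :=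
  kept_edge x y || [exists s, [exists i : 'I_t, path_edge s i x y]].

Lemma path_edgeC t s i : symmetric (@path_edge t s i).
Proof. by move=> x y; rewrite /path_edge orbC. Qed.

Lemma subdiv_edge_sym t : symmetric (@subdiv_edge t).
Proof.
move=> x y; rewrite /subdiv_edge; congr (_ || _).
  by case: x y => [u|p] [v|q] //=; rewrite sedge_sym finset.setUC.
by apply: eq_existsb => s; apply: eq_existsb => i; rewrite path_edgeC.
Qed.

Lemma at_posS t s (i : 'I_t) x : @at_pos t s i x -> ~~ at_pos s i.+1 x.
Proof.
case: x => [v|[s' j]] /=; last first.
  by move=> /andP[-> /eqP->]; rewrite eqn_leq ltnn.
have /negPf neq_it : nat_of_ord i != t by rewrite neq_ltn ltn_ord.
rewrite neq_it orbF => /andP[_ e0]; apply/negP => /andP[_ e1].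
have := enum_uniq (val s); move: e0 e1.
by case: (enum (val s)) => [|a [|b l]] //= /eqP[->] /eqP[->]; rewrite inE eqxx.
Qed.

Lemma subdiv_edge_irr t : irreflexive (@subdiv_edge t).
Proof.
move=> x; apply/negP => /orP[|/existsP[s /existsP[i]]].
  by case: x => [u|p] //=; rewrite sedge_irr.
by rewrite /path_edge orbb => /andP[/at_posS/negPf->].
Qed.

(* G_t(S), for t >= 1 *)
Definition subdiv (t : nat) : sgraph :=
  SGraph (@subdiv_edge_sym t) (@subdiv_edge_irr t).

(* The middle one of the [2t+1] edges of a path joins positions [t] and
   [t+1]. *)
Definition cut_edge (t : nat) (x y : subdiv (2 * t).+1) : bool :=
  sedge x y && ~~ [exists s, path_edge s t x y].

Lemma cut_edge_sym t : symmetric (@cut_edge t).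
Proof.
move=> x y; rewrite /cut_edge sedge_sym; congr (_ && ~~ _).
by apply: eq_existsb => s; rewrite path_edgeC.
Qed.

Lemma cut_edge_irr t : irreflexive (@cut_edge t).
Proof. by move=> x; rewrite /cut_edge sedge_irr. Qed.

(* H_t(S), for t >= 1 *)
Definition cut_subdiv (t : nat) : sgraph :=
  SGraph (@cut_edge_sym t) (@cut_edge_irr t).

End Subdivision.

(* Main.v *)
Require Import Defs.
From mathcomp Require Import all_boot all_order all_algebra.
From mathcomp Require Import all_classical all_reals all_analysis.
From mathcomp Require Import perm polyrcf complex ring lra zify.

Import numFieldNormedType.Exports.

(* Let [X] be [G_N(S)] or [H_n(S)] (where [N = 2n+1]). When its paths are long
   enough, [H_t] is the subgraph of [X] induced on the vertices at distance at
   most [t] from [G], so [lambda_k(H_t) <= lambda_k(X)] by interlacing.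

   Conversely, let [chi] be [1] near [G] and decrease linearly to [0] at distance
   [t+1]. Replacing a vector [f] on [X] by [chi * f] loses at most
   [2 (|f|^2 - |chi f|^2) + (2/t) |f|^2] in the quadratic form of the adjacency
   matrix, because the vertices off [G] have degree at most 2. By Courant-Fischer,
   [lambda_k(X) <= max(lambda_k(H_t), 2) + 2/t].

   If [S] is nonempty, [H_t] contains [k] disjoint induced paths with [L]
   vertices as soon as [t >= k (L+1)], so [lambda_k(H_t) >= 2 - 2/L]. Hence for
   [t] large both sequences eventually stay within [e] of [lambda_k(H_t)]. *)

Set Implicit Arguments.
Unset Strict Implicit.
Unset Printing Implicit Defensive.

Import Order.TTheory GRing.Theory Num.Theory.
Local Open Scope ring_scope.

(** * Spectral theorem for symmetric matrices over a real closed field *)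

Section SymmetricMatrices.
Variable R : rcfType.

Lemma mx00E : ((forall A B : 'M[R]_1, ((A + B) 0 0 = A 0 0 + B 0 0)%R)
  * (forall A : 'M[R]_1, ((- A) 0 0 = - A 0 0)%R)
  * (forall a (A : 'M[R]_1), ((a *: A) 0 0 = a * A 0 0)%R))%type.
Proof. by do !split => *; rewrite mxE. Qed.

Lemma dotmxC n (u v : 'rV[R]_n) : (u *m v^T) 0 0 = (v *m u^T) 0 0.
Proof.
have -> : u *m v^T = (v *m u^T)^T by rewrite trmx_mul trmxK.
by rewrite mxE.
Qed.

Lemma dotmx_ge0 n (v : 'rV[R]_n) : 0 <= (v *m v^T) 0 0.
Proof. by rewrite mxE; apply: sumr_ge0 => i _; rewrite mxE -expr2 sqr_ge0. Qed.

Lemma dotmx_gt0 n (v : 'rV[R]_n) : v != 0 -> 0 < (v *m v^T) 0 0.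
Proof.
move=> vN0; rewrite lt_def dotmx_ge0 andbT; apply: contraNneq vN0 => vv0.
apply/eqP/rowP => i; rewrite mxE; apply/eqP; rewrite -sqrf_eq0; apply/eqP.
have /psumr_eq0P : \sum_j v 0 j ^+ 2 = 0.
  by rewrite -[RHS]vv0 mxE; apply: eq_bigr => j _; rewrite mxE expr2.
by apply=> // j _; rewrite sqr_ge0.
Qed.

(* An eigenvector [x + iy] for [a + ib] satisfies [xA = ax - by] and
   [yA = bx + ay], whence [b (|x|^2 + |y|^2) = 0] by symmetry. *)
Lemma sym_eigenvalue n (A : 'M[R]_n) :
  (0 < n)%N -> A^T = A -> exists a, eigenvalue A a.
Proof.
move=> n0 Asym; pose AC := map_mx (real_complex R) A.
have [z rz] : exists z, root (char_poly AC) z.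
  by apply/closed_rootP; rewrite size_char_poly; case: (n) n0.
move: rz; rewrite -eigenvalue_root_char => /eigenvalueP[v vA vN0].
pose x : 'rV[R]_n := map_mx (@complex.Re R) v.
pose y : 'rV[R]_n := map_mx (@complex.Im R) v.
have xA : x *m A = complex.Re z *: x - complex.Im z *: y.
  apply/rowP => j; have /rowP/(_ j) := vA.
  rewrite !mxE => /(congr1 (@complex.Re R)).
  rewrite (raddf_sum (@complex.Re R : {additive Rcomplex R -> R})).
  have -> : complex.Re (z * v 0 j) =
      complex.Re z * complex.Re (v 0 j) - complex.Im z * complex.Im (v 0 j).
    by case: z {vA} (v 0 j) => [a b] [c d].
  move=> <-; apply: eq_bigr => i _; rewrite !mxE.
  by case: (v 0 i) => c d /=; rewrite mulr0 subr0.
have yA : y *m A = complex.Im z *: x + complex.Re z *: y.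
  apply/rowP => j; have /rowP/(_ j) := vA.
  rewrite !mxE => /(congr1 (@complex.Im R)).
  rewrite (raddf_sum (@complex.Im R : {additive Rcomplex R -> R})).
  have -> : complex.Im (z * v 0 j) =
      complex.Im z * complex.Re (v 0 j) + complex.Re z * complex.Im (v 0 j).
    by case: z {vA xA} (v 0 j) => [a b] [c d] /=; rewrite addrC.
  move=> <-; apply: eq_bigr => i _; rewrite !mxE.
  by case: (v 0 i) => c d /=; rewrite mulr0 add0r.
have vN0' : (x != 0) || (y != 0).
  rewrite -negb_and; apply: contraNN vN0 => /andP[/eqP/rowP x0 /eqP/rowP y0].
  apply/eqP/rowP => j; have := x0 j; have := y0 j; rewrite !mxE.
  by case: (v 0 j) => a b /= -> ->.
have b0 : complex.Im z = 0.
  have xy : (x *m A *m y^T) 0 0 = (y *m A *m x^T) 0 0.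
    have -> : x *m A *m y^T = (y *m A *m x^T)^T.
      by rewrite !trmx_mul trmxK Asym mulmxA.
    by rewrite mxE.
  have yx := dotmxC y x.
  move: xy; rewrite xA yA !mulmxDl !mulNmx -!scalemxAl !mx00E yx => E.
  have xx := dotmx_ge0 x; have yy := dotmx_ge0 y.
  have : complex.Im z * ((x *m x^T) 0 0 + (y *m y^T) 0 0) = 0 by lra.
  move=> /eqP; rewrite mulf_eq0 => /orP[/eqP//|/eqP s0].
  by case/orP: vN0' => /dotmx_gt0; lra.
exists (complex.Re z); case/orP: vN0' => [x0|y0]; apply/eigenvalueP.
  by exists x => //; rewrite xA b0 scale0r subr0.
by exists y => //; rewrite yA b0 scale0r add0r.
Qed.

(** The reflection along [w = e - v] exchanges the unit vectors [e] and [v]. For [e = v] it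
    degenerates, and the identity serves. *)
Lemma householder n (v : 'rV[R]_n.+1) : (v *m v^T) 0 0 = 1 ->
  exists H : 'M[R]_n.+1, [/\ H^T = H, H *m H = 1%:M & row 0 H = v].
Proof.
move=> v1; pose e : 'rV[R]_n.+1 := delta_mx 0 0.
have [<-|ev] := eqVneq e v.
  by exists 1%:M; rewrite trmx1 mulmx1 row1.
have [w wE] : exists w, w = e - v by exists (e - v).
have wN0 : w != 0 by rewrite wE subr_eq0.
have w0 := dotmx_gt0 wN0; set q := (w *m w^T) 0 0 in w0.
have wwE : w *m w^T = q%:M by rewrite [LHS]mx11_scalar.
exists (1%:M - (2 / q) *: (w^T *m w)); split.
- by rewrite linearB linearZ /= trmx_mul trmxK trmx1.
- have XX : (w^T *m w) *m (w^T *m w) = q *: (w^T *m w).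
    by rewrite mulmxA -(mulmxA w^T) wwE mul_mx_scalar -scalemxAl.
  rewrite mulmxBl mul1mx mulmxBr mulmx1 -scalemxAl -scalemxAr XX !scalerA.
  have -> : 2 / q * (2 / q) * q = 2 / q + 2 / q by field; lra.
  by rewrite scalerDl opprB addrK subrK.
(* Both vectors are units, so [|e - v|^2 = 2 - 2 e.v = 2 e.w]. *)
have ew : (e *m w^T) 0 0 * 2 = q.
  rewrite /q wE linearB /= mulmxBl !mulmxBr !mx00E.
  have ee : (e *m e^T) 0 0 = 1 by rewrite trmx_delta mul_delta_mx mxE eqxx.
  have ve := dotmxC v e.
  lra.
rewrite rowE -/e mulmxBr mulmx1 -scalemxAr mulmxA.
rewrite [e *m w^T]mx11_scalar mul_scalar_mx scalerA.
have -> : 2 / q * (e *m w^T) 0 0 = 1 by rewrite -ew; field; lra.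
by rewrite scale1r wE opprB addrC subrK.
Qed.

(** Deflation: conjugating by a reflection whose first row is a unit eigenvector clears the first
    row and, by symmetry, the first column off the diagonal. A symmetric block of size [n]
    remains. *)
Lemma sym_diagonalizable n (A : 'M[R]_n) : A^T = A ->
  exists (P : 'M[R]_n) (d : 'rV[R]_n),
    P *m P^T = 1%:M /\ A = P^T *m diag_mx d *m P.
Proof.
elim: n A => [|n IHn] A Asym.
  by exists 1%:M, 0; split; apply/matrixP => - [].
have [a /eigenvalueP[u uA u0]] := sym_eigenvalue (ltn0Sn n) Asym.
pose r := Num.sqrt ((u *m u^T) 0 0); pose v := r^-1 *: u.
have r2 : r ^+ 2 = (u *m u^T) 0 0 by rewrite sqr_sqrtr ?dotmx_ge0.
have r0 : 0 < r by rewrite sqrtr_gt0 dotmx_gt0.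
have v1 : (v *m v^T) 0 0 = 1.
  rewrite /v linearZ /= -scalemxAl -scalemxAr !mx00E -r2; field; exact: lt0r_neq0.
have vA : v *m A = a *: v by rewrite -scalemxAl uA !scalerA mulrC.
have [H [Hsym HH rowH]] := householder v1.
have [B BdefH] : exists B : 'M[R]_(1 + n), B = H *m A *m H.
  by exists (H *m A *m H).
have Bsym : B^T = B by rewrite BdefH !trmx_mul Hsym Asym mulmxA.
have rowB : row 0 B = a *: delta_mx 0 0.
  by rewrite BdefH !row_mul rowH vA -scalemxAl -rowH rowE -mulmxA HH mulmx1.
have B0 j : B 0 j = a * (j == 0)%:R by have /rowP/(_ j) := rowB; rewrite !mxE.
have Bur : ursubmx B = 0 by apply/rowP => j; rewrite !mxE lshift0 B0 mulr0.
have Bul : ulsubmx B = a%:M.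
  by apply/rowP => j; rewrite !mxE !ord1 lshift0 B0 mulr1.
have Bdl : dlsubmx B = 0.
  by rewrite -[dlsubmx B]trmxK trmx_dlsub Bsym Bur trmx0.
have [|P [d [PP BE]]] := IHn (drsubmx B); first by rewrite trmx_drsub Bsym.
pose Q : 'M[R]_(1 + n) := block_mx 1%:M 0 0 P.
have QQ : Q *m Q^T = 1%:M.
  rewrite tr_block_mx mulmx_block !trmx0 trmx1 !mulmx0 !mul0mx !addr0 add0r.
  by rewrite mulmx1 PP -scalar_mx_block.
have BQ : B = Q^T *m diag_mx (row_mx a%:M d) *m Q.
  rewrite -[LHS]submxK Bur Bul Bdl BE diag_mx_row tr_block_mx !mulmx_block.
  rewrite !trmx0 !trmx1 !(mulmx0, mul0mx, addr0, add0r, mulmx1, mul1mx).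
  by congr (block_mx _ _ _ _); apply/rowP => j; rewrite !mxE !ord1.
exists (Q *m H), (row_mx a%:M d); split.
  by rewrite trmx_mul Hsym mulmxA -(mulmxA Q) HH mulmx1.
have -> : A = H *m B *m H by rewrite BdefH !mulmxA HH mul1mx -mulmxA HH mulmx1.
by rewrite BQ trmx_mul Hsym !mulmxA.
Qed.

Lemma char_poly_similar_diag n (A P : 'M[R]_n) (d : 'rV[R]_n) :
  P *m P^T = 1%:M -> A = P^T *m diag_mx d *m P ->
  char_poly A = \prod_(i < n) ('X - (d 0 i)%:P).
Proof.
move=> PP AE; have PP' := mulmx1C PP.
pose Pp := map_mx (@polyC R) P; pose Pt := map_mx (@polyC R) P^T.
have PtPp : Pt *m Pp = 1%:M by rewrite -map_mxM PP' map_mx1.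
have -> : char_poly A = char_poly (diag_mx d).
  rewrite /char_poly.
  have -> : char_poly_mx A = Pt *m char_poly_mx (diag_mx d) *m Pp.
    rewrite /char_poly_mx mulmxBr mulmxBl -!map_mxM -AE; congr (_ - _).
    by rewrite mul_mx_scalar -scalemxAl PtPp scalemx1.
  by rewrite !det_mulmx mulrAC -det_mulmx PtPp det1 mul1r.
rewrite char_poly_trig ?diag_mx_is_trig //.
by apply: eq_bigr => i _; rewrite mxE eqxx.
Qed.

Lemma mup_prod_XsubC (s : seq R) x :
  mup x (\prod_(y <- s) ('X - y%:P)) = count_mem x s.
Proof.
elim: s => [|y s IHs].
  by rewrite big_nil mupNroot // root1.
rewrite big_cons mupM ?polyXsubC_eq0 //; last first.
  by rewrite monic_neq0 // monic_prod_XsubC.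
by rewrite IHs -['X - y%:P]expr1 mup_XsubCX /= eq_sym; case: eqP.
Qed.
End SymmetricMatrices.

(** * Eigenvalue bounds by the Courant-Fischer method *)

Section CourantFischer.
Variable R : rcfType.

Lemma perm_rootsR_mup (s : seq R) (p := \prod_(x <- s) ('X - x%:P)) :
  perm_eq (flatten [seq nseq (mup x p) x | x <- rootsR p]) s.
Proof.
have p0 : p != 0 by rewrite monic_neq0 // monic_prod_XsubC.
apply/allP => y _ /=; rewrite count_flatten -map_comp sumnE big_map.
have [ys|ys] := boolP (y \in s).
  have yr : y \in rootsR p.
    by rewrite -roots_on_rootsR // root_prod_XsubC.
  rewrite (bigD1_seq y) ?uniq_roots //= count_nseq /= eqxx mul1n mup_prod_XsubC.
  rewrite big1 ?addn0 // => x xy.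
  by rewrite /= count_nseq /= (negPf xy).
rewrite (count_memPn ys) big1_seq // => x /andP[_]; rewrite -roots_on_rootsR //=.
rewrite root_prod_XsubC => xs; rewrite count_nseq /=; case: eqP => // xy.
by rewrite -xy xs in ys.
Qed.

(** The diagonal of any diagonalization is a permutation of the sorted spectrum; permuting the rows
    of [P] accordingly makes the orders agree. *)
Lemma spectral_decomposition n (A : 'M[R]_n) : A^T = A ->
  size (spectrum A) = n /\ exists P : 'M[R]_n, P *m P^T = 1%:M /\
    A = P^T *m diag_mx (\row_i (spectrum A)`_i) *m P.
Proof.
move=> /sym_diagonalizable[P [d [PP AE]]].
pose ds := [tuple d 0 i | i < n].
have perm : perm_eq (spectrum A) ds.
  rewrite /spectrum perm_sort (char_poly_similar_diag PP AE).
  have -> : \prod_(i < n) ('X - (d 0 i)%:P) = \prod_(x <- ds) ('X - x%:P).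
    by rewrite big_map big_enum.
  exact: perm_rootsR_mup.
have szA : size (spectrum A) = n by rewrite (perm_size perm) size_tuple.
split=> //; have /tuple_permP[s sE] := perm.
exists (row_perm s P); split.
  apply/matrixP => i j; have /matrixP/(_ (s i) (s j)) := PP.
  rewrite !mxE (inj_eq perm_inj) => <-; apply: eq_bigr => k _; by rewrite !mxE.
apply/matrixP => i j; rewrite [in LHS]AE !mul_mx_diag !mxE.
rewrite (reindex_inj (@perm_inj _ s)) /=; apply: eq_bigr => k _.
rewrite !mxE; congr (_ * _ * _).
have -> : (spectrum A)`_k = tnth [tuple tnth ds (s i) | i < n] k.
  by rewrite (tnth_nth 0) sE.
by rewrite !tnth_mktuple.
Qed.

Lemma spectrum_ge n (A : 'M[R]_n) i j : A^T = A -> (i <= j)%N -> (j < n)%N ->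
  (spectrum A)`_j <= (spectrum A)`_i.
Proof.
move=> /spectral_decomposition[szA _] ij jn.
have ge_trans : transitive (>=%R : rel R).
  by move=> x y z /= xy yz; exact: le_trans yz xy.
have ge_refl : reflexive (>=%R : rel R) by move=> x /=.
apply: (sorted_leq_nth ge_trans ge_refl) => //; rewrite ?inE ?szA //.
  by apply: sort_sorted => x y; exact: le_total.
exact: leq_ltn_trans jn.
Qed.

Lemma spectral_forms n (A : 'M[R]_n) : A^T = A ->
  exists P : 'M[R]_n, P *m P^T = 1%:M /\ forall v : 'rV_n,
    (v *m A *m v^T) 0 0 = \sum_(i < n) (spectrum A)`_i * (v *m P^T) 0 i ^+ 2 /\
    (v *m v^T) 0 0 = \sum_(i < n) (v *m P^T) 0 i ^+ 2.
Proof.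
move=> /spectral_decomposition[_ [P [PP AE]]]; exists P; split=> // v; split.
  have -> : v *m A *m v^T =
      v *m P^T *m diag_mx (\row_i (spectrum A)`_i) *m (v *m P^T)^T.
    by rewrite trmx_mul trmxK [in LHS]AE !mulmxA.
  rewrite mxE; apply: eq_bigr => i _.
  by rewrite mul_mx_diag ![_^T i 0]mxE [X in X * _]mxE [X in _ * X * _]mxE; ring.
have -> : v *m v^T = v *m P^T *m (v *m P^T)^T.
  by rewrite trmx_mul trmxK mulmxA -(mulmxA v) (mulmx1C PP) mulmx1.
by rewrite mxE; apply: eq_bigr => i _; rewrite ![_^T i 0]mxE expr2.
Qed.

(** The rows of [U] are orthonormal eigenvectors for the [k.+1] largest eigenvalues. *)
Lemma spectrum_subspace n (A : 'M[R]_n) k : A^T = A -> (k < n)%N ->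
  exists U : 'M[R]_(k.+1, n), forall u : 'rV_k.+1,
    (u *m U *m (u *m U)^T) 0 0 = (u *m u^T) 0 0 /\
    (spectrum A)`_k * (u *m u^T) 0 0 <= (u *m U *m A *m (u *m U)^T) 0 0.
Proof.
move=> Asym kn; have [P [PP PE]] := spectral_forms Asym.
pose U := rowsub (widen_ord kn) P; exists U => u.
have UU : U *m U^T = 1%:M.
  apply/matrixP => i j.
  have /matrixP/(_ (widen_ord kn i) (widen_ord kn j)) := PP.
  by rewrite !mxE => <-; apply: eq_bigr => x _; rewrite !mxE.
have uU : u *m U *m (u *m U)^T = u *m u^T.
  by rewrite trmx_mul mulmxA -(mulmxA u) UU mulmx1.
split; first by rewrite uU.
rewrite -uU; have [-> ->] := PE (u *m U); rewrite mulr_sumr.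
apply: ler_sum => i _; have [ik|ki] := leqP i k.
  by rewrite ler_wpM2r ?sqr_ge0 // spectrum_ge.
have -> : (u *m U *m P^T) 0 i = 0; last by rewrite expr0n /= !mulr0.
rewrite -mulmxA mul_rowsub_mx PP mxE big1 // => j _; rewrite !mxE.
case: eqP => [ji|]; last by rewrite mulr0.
by move: ki; rewrite -ji /= ltnNge -ltnS ltn_ord.
Qed.

(** The columns of [W] are eigenvectors for the [k] largest eigenvalues, so [v *m W = 0] leaves only
    components of index at least [k]. *)
Lemma spectrum_cosubspace n (A : 'M[R]_n) k : A^T = A -> (k < n)%N ->
  exists W : 'M[R]_(n, k), forall v : 'rV_n, v *m W = 0 ->
    (v *m A *m v^T) 0 0 <= (spectrum A)`_k * (v *m v^T) 0 0.
Proof.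
move=> Asym kn; have [P [PP PE]] := spectral_forms Asym.
exists (colsub (widen_ord (ltnW kn)) P^T) => v vW.
have [-> ->] := PE v; rewrite mulr_sumr.
apply: ler_sum => i _; have [ki|ik] := leqP k i.
  by rewrite ler_wpM2r ?sqr_ge0 // spectrum_ge.
have -> : (v *m P^T) 0 i = 0; last by rewrite expr0n /= !mulr0.
have /rowP/(_ (Ordinal ik)) := vW; rewrite mulmx_colsub !mxE => vW0; rewrite -[RHS]vW0.
by apply: eq_bigr => j _; rewrite !mxE; congr (_ * P _ _); exact/val_inj.
Qed.

(* Dimension count: a row space of dimension [k.+1] meets the subspace of
   codimension [k] on which the form of [B] is at most its [k]-th eigenvalue
   (counted from 0). *)
Lemma spectrum_meet n m (B : 'M[R]_n) (C : 'M[R]_(m, n)) k :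
  B^T = B -> (k < n)%N -> (k < m)%N ->
  exists2 u : 'rV_m, u != 0 &
    (u *m C *m B *m (u *m C)^T) 0 0 <=
    (spectrum B)`_k * (u *m C *m (u *m C)^T) 0 0.
Proof.
move=> Bsym kn km; have [W WP] := spectrum_cosubspace Bsym kn.
have : kermx (C *m W) != 0.
  rewrite kermx_eq0 /row_free neq_ltn.
  by rewrite (leq_ltn_trans (rank_leq_col _) km).
case/rowV0Pn => u /sub_kermxP uCW u0; exists u => //.
by apply: WP; rewrite -mulmxA.
Qed.

(** The Rayleigh quotient is constantly [b / a] on the row space of [C]. *)
Lemma le_spectrum_of_test n (B : 'M[R]_n) k (C : 'M[R]_(k.+1, n)) (a b : R) :
  B^T = B -> (k < n)%N -> 0 < a -> C *m C^T = a%:M -> C *m B *m C^T = b%:M ->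
  b / a <= (spectrum B)`_k.
Proof.
move=> Bsym kn a0 CC CBC; have [u u0] := spectrum_meet C Bsym kn (ltnSn k).
have uu : (u *m C *m (u *m C)^T) = a *: (u *m u^T).
  by rewrite trmx_mul mulmxA -(mulmxA u) CC mul_mx_scalar scalemxAl.
have -> : u *m C *m B *m (u *m C)^T = b *: (u *m u^T).
  by rewrite trmx_mul !mulmxA -!(mulmxA u) CBC mul_scalar_mx scalemxAr.
have u1 := dotmx_gt0 u0.
by rewrite uu !mx00E mulrA ler_pM2r // ler_pdivrMr.
Qed.

(** [C] may shrink or kill vectors. The norm lost, [|v|^2 - |vC|^2], is charged at rate [c], and the
    norm kept at the eigenvalue of [B], so the larger rate bounds both. *)
Lemma le_spectrum_of_form n m (A : 'M[R]_n) (B : 'M[R]_m) (C : 'M[R]_(n, m))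
    (c e : R) k :
  A^T = A -> B^T = B -> (k < n)%N -> (k < m)%N ->
  (forall v : 'rV_n, (v *m C *m (v *m C)^T) 0 0 <= (v *m v^T) 0 0) ->
  (forall v : 'rV_n, (v *m A *m v^T) 0 0 <=
     (v *m C *m B *m (v *m C)^T) 0 0 +
     c * ((v *m v^T) 0 0 - (v *m C *m (v *m C)^T) 0 0) + e * (v *m v^T) 0 0) ->
  (spectrum A)`_k <= Num.max (spectrum B)`_k c + e.
Proof.
move=> Asym Bsym kn km leC leA; have [U UP] := spectrum_subspace Asym kn.
have [u u0 uB] := spectrum_meet (U *m C) Bsym km (ltnSn k).
have [uU uA] := UP u; have u1 := dotmx_gt0 u0.
(* Here [x = |v|^2], [y = |vC|^2] and [M] is the maximum; the last two premises come from
   [0 <= y <= x]. *)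
have arith (x y a b M lA lB : R) : lA * x <= a -> a <= b + c * (x - y) + e * x ->
    b <= lB * y -> lB * y <= M * y -> c * (x - y) <= M * (x - y) ->
    lA * x <= (M + e) * x by lra.
rewrite -uU in u1 uA; rewrite -(ler_pM2r u1).
rewrite !mulmxA in uB; apply: arith uA (leA _) uB _ _.
  by rewrite ler_wpM2r ?dotmx_ge0 // le_max lexx.
by rewrite ler_wpM2r ?subr_ge0 ?leC // le_max lexx orbT.
Qed.
End CourantFischer.

(** * Eigenvalues and induced subgraphs: interlacing and cutoff *)

Section InducedSubgraphs.
Variable R : rcfType.

Lemma adjacency_sym (G : sgraph) : (adjacency R G)^T = adjacency R G.
Proof. by apply/matrixP => i j; rewrite !mxE sedge_sym. Qed.

Lemma size_spectrum_adjacency (G : sgraph) :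
  size (spectrum (adjacency R G)) = #|G|.
Proof. by case: (spectral_decomposition (adjacency_sym G)). Qed.

Lemma sum_enum_val (T : finType) (F : T -> R) :
  \sum_(i < #|T|) F (enum_val i) = \sum_x F x.
Proof. by rewrite -(big_enum_val (A := T)). Qed.

Lemma adjacency_form (G : sgraph) (F : G -> R) (v := \row_i F (enum_val i)) :
  (v *m adjacency R G *m v^T) 0 0 = \sum_x \sum_y (sedge x y)%:R * (F x * F y)
  /\ (v *m v^T) 0 0 = \sum_x F x ^+ 2.
Proof.
split; rewrite mxE -[RHS]sum_enum_val.
  rewrite [RHS](eq_bigr _ (fun i _ => esym (sum_enum_val _))) exchange_big /=.
  apply: eq_bigr => j _; rewrite !mxE mulr_suml.
  by apply: eq_bigr => i _; rewrite !mxE; ring.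
by apply: eq_bigr => i _; rewrite !mxE expr2.
Qed.

Variables (X Y : sgraph) (phi : Y -> X).
Hypothesis phi_inj : injective phi.
Hypothesis phi_edge : forall y z, sedge (phi y) (phi z) = sedge y z.

Lemma leq_card_induced : (#|Y| <= #|X|)%N.
Proof. exact: leq_card phi_inj. Qed.

(** Interlacing: extension by zero preserves the norm and the quadratic form. *)
Lemma lambda_induced k : (0 < k <= #|Y|)%N -> lambda R k Y <= lambda R k X.
Proof.
case: k => //= k kY; have kX := leq_trans kY leq_card_induced.
pose h (j : 'I_#|Y|) := enum_rank (phi (enum_val j)).
pose C : 'M[R]_(#|Y|, #|X|) := rowsub h 1%:M.
have hinj : injective h by move=> i j /enum_rank_inj/phi_inj/enum_val_inj.
have CC : C *m C^T = 1%:M.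
  rewrite mul_rowsub_mx mul1mx; apply/matrixP => i j.
  by rewrite !mxE eq_sym (inj_eq hinj).
have CAC : C *m adjacency R X *m C^T = adjacency R Y.
  rewrite !mul_rowsub_mx mul1mx; apply/matrixP => i j.
  rewrite !mxE (bigD1 (h j)) //= big1 => [|x xj]; last first.
    by rewrite !mxE eq_sym (negPf xj) mulr0.
  by rewrite !mxE eqxx !enum_rankK phi_edge addr0 mulr1.
have dotC (v : 'rV_#|Y|) : v *m C *m (v *m C)^T = v *m v^T.
  by rewrite trmx_mul mulmxA -(mulmxA v) CC mulmx1.
rewrite /lambda /=; set b := (spectrum (adjacency R X))`_k.
(* No norm is lost, so [c] may be the eigenvalue itself and [e] zero. *)
rewrite -[b]addr0 -[b]maxxx.
apply: (@le_spectrum_of_form _ _ _ _ _ C) => // [||v|v].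
- exact: adjacency_sym.
- exact: adjacency_sym.
- by rewrite dotC.
by rewrite dotC subrr mulr0 mul0r !addr0 trmx_mul mulmxA -!(mulmxA v) -CAC !mulmxA.
Qed.

(* By AM-GM each edge term satisfies
   [(1 - chi x * chi y) * (f x * f y)
    <= (1 - chi x * chi y) * (f x ^+ 2 + f y ^+ 2) / 2],
   so that replacing [f] by its truncation [chi * f] costs at most
   [(c * (1 - chi x ^+ 2) + e) * f x ^+ 2] at each vertex [x]. *)
Lemma lambda_cutoff (chi : X -> R) (c e : R) k :
    (forall x, 0 <= chi x <= 1) ->
    (forall x, chi x != 0 -> x \in codom phi) ->
    (forall x, \sum_(y | sedge x y) (1 - chi x * chi y) <= c * (1 - chi x ^+ 2) + e) ->
    (0 < k <= #|Y|)%N ->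
  lambda R k X <= Num.max (lambda R k Y) c + e.
Proof.
move=> chi01 chi_phi chi_sum; case: k => //= k kY.
have kX := leq_trans kY leq_card_induced.
pose h (j : 'I_#|Y|) := enum_rank (phi (enum_val j)).
(* Multiplication by [chi], then restriction to [Y]; nothing is lost by restricting, as [chi]
   vanishes off the image of [phi]. *)
pose C : 'M[R]_(#|X|, #|Y|) :=
  \matrix_(i, j) (chi (enum_val i) * (enum_val i == phi (enum_val j))%:R).
have sum_phi (F : X -> R) : (forall x, chi x = 0 -> F x = 0) ->
    \sum_y F (phi y) = \sum_x F x.
  move=> F0; rewrite [RHS](bigID (mem (codom phi))) /= [X in _ + X]big1 ?addr0.
    rewrite -[LHS](big_imset (h := phi) (A := predT)) /=; last exact: in2W.
    apply: eq_bigl => x; apply/imsetP/codomP => [[y _ ->]|[y ->]]; by exists y.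
  move=> x xphi; apply: F0; apply/eqP; apply: contraNT xphi; exact: chi_phi.
pose f (v : 'rV[R]_#|X|) x := v 0 (enum_rank x).
have vE v : v = \row_i f v (enum_val i).
  by apply/rowP => i; rewrite !mxE /f enum_valK.
pose g v x := chi x * f v x.
have vCE v : v *m C = \row_j g v (phi (enum_val j)).
  apply/rowP => j; rewrite !mxE (bigD1 (h j)) //= big1 => [|i ij]; last first.
    rewrite !mxE; case: eqP => [E|]; last by rewrite !mulr0.
    by case/eqP: ij; rewrite /h -E enum_valK.
  by rewrite !mxE /h !enum_rankK eqxx mulr1 addr0 mulrC.
have normC v : (v *m C *m (v *m C)^T) 0 0 = \sum_x g v x ^+ 2.
  rewrite vCE (adjacency_form (fun y => g v (phi y))).2.
  by apply: (sum_phi (fun x => g v x ^+ 2)) => x x0; rewrite /g x0 mul0r expr0n.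
have formC v : (v *m C *m adjacency R Y *m (v *m C)^T) 0 0 =
    \sum_x \sum_y (sedge x y)%:R * (g v x * g v y).
  rewrite vCE (adjacency_form (fun y => g v (phi y))).1.
  rewrite -(sum_phi (fun x => \sum_y (sedge x y)%:R * (g v x * g v y))); last first.
    by move=> x x0; apply: big1 => y _; rewrite /g x0 mul0r mul0r mulr0.
  apply: eq_bigr => y _.
  rewrite -(sum_phi (fun z => (sedge (phi y) z)%:R * (g v (phi y) * g v z))).
    by apply: eq_bigr => z _; rewrite phi_edge.
  by move=> x x0; rewrite /g x0 mul0r mulr0 mulr0.
have norm v : (v *m v^T) 0 0 = \sum_x f v x ^+ 2.
  by rewrite {1 2}(vE v) (adjacency_form (f v)).2.
have form v : (v *m adjacency R X *m v^T) 0 0 =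
    \sum_x \sum_y (sedge x y)%:R * (f v x * f v y).
  by rewrite {1 2}(vE v) (adjacency_form (f v)).1.
rewrite /lambda /=.
apply: (@le_spectrum_of_form _ _ _ _ _ C) => // [||v|v].
- exact: adjacency_sym.
- exact: adjacency_sym.
- rewrite normC norm; apply: ler_sum => x _.
  rewrite /g exprMn ler_piMl ?sqr_ge0 //.
  by have /andP[? ?] := chi01 x; rewrite expr_le1.
rewrite normC norm form formC; rewrite /g.
move: (f v) => {g vCE normC formC norm form f vE sum_phi C h v}F.
pose w x y := (sedge x y)%:R * (1 - chi x * chi y).
have w_ge0 x y : 0 <= w x y.
  rewrite mulr_ge0 ?ler0n // subr_ge0.
  by have /andP[? ?] := chi01 x; have /andP[? ?] := chi01 y; rewrite mulr_ile1.
have wC x y : w x y = w y x by rewrite /w sedge_sym mulrC (mulrC (chi x)) mulrC.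
pose S := \sum_x \sum_y w x y * F x ^+ 2.
have SE : \sum_x \sum_y w x y * F y ^+ 2 = S.
  rewrite exchange_big; apply: eq_bigr => x _; apply: eq_bigr => y _.
  by rewrite wC.
have S_le : S <= c * (\sum_x F x ^+ 2 - \sum_x (chi x * F x) ^+ 2) +
    e * \sum_x F x ^+ 2.
  rewrite -sumrB !mulr_sumr -big_split; apply: ler_sum => x _ /=.
  have : \sum_y w x y <= c * (1 - chi x ^+ 2) + e.
    apply: le_trans (chi_sum x); rewrite [leRHS]big_mkcond /=.
    by apply: ler_sum => y _; rewrite /w; case: ifP; rewrite ?mul1r ?mul0r.
  rewrite -mulr_suml => /(ler_wpM2r (sqr_ge0 (F x)))/le_trans; apply.
  by rewrite le_eqVlt; apply/orP; left; apply/eqP; ring.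
(* Halving [S] and reindexing one half by [SE] gives each ordered pair the share
   [w x y * (F x ^+ 2 + F y ^+ 2) / 2] required by AM-GM. *)
apply: le_trans (_ : _ <= \sum_x \sum_y (sedge x y)%:R *
    (chi x * F x * (chi y * F y)) + (2^-1 * S + 2^-1 * S)) _; last first.
  have -> : 2^-1 * S + 2^-1 * S = S by field.
  by rewrite -addrA lerD2l.
rewrite -{2}SE /S !mulr_sumr -!big_split; apply: ler_sum => x _ /=.
rewrite !mulr_sumr -!big_split; apply: ler_sum => y _ /=.
have := mulr_ge0 (w_ge0 x y) (sqr_ge0 (F x - F y)).
rewrite /w; set a := _%:R; move: a (chi x) (chi y) (F x) (F y) => a p q u v' h.
nra.
Qed.
End InducedSubgraphs.

(** * Positions, distances and degrees on the subdivided paths *)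

Section Positions.
Local Open Scope nat_scope.
Variables (G : sgraph) (S : {set {set G}}) (N : nat).
Local Notation V := (subdiv_vertex S N).
Implicit Types (s : {s : {set G} | s \in S}) (x y : V).

(** Distance to the nearer end of the path: the internal vertex [j] has position [j.+1]. *)
Definition core_dist (x : V) : nat :=
  match x with inl _ => 0 | inr (_, j) => minn j.+1 (N - j.+1) end.

Lemma at_pos_dist s i x : at_pos s i x -> core_dist x = minn i (N - i).
Proof.
case: x => [v|[s' j]] /=; last by case/andP => _ /eqP->.
by case/orP => /andP[/eqP-> _]; rewrite ?subn0 ?subnn ?min0n ?minn0.
Qed.

Lemma subdiv_edge_dist x y : subdiv_edge x y -> core_dist y <= (core_dist x).+1.
Proof.
case/orP => [|/existsP[s /existsP[m]]].
  by case: x y => [u|p] [v|q].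
by case/orP => /andP[/at_pos_dist-> /at_pos_dist->]; have := ltn_ord m; lia.
Qed.

Lemma at_pos_inner s i s' (j : 'I_N.-1) :
  at_pos s i (inr (s', j) : V) -> s = s' /\ i = j.+1.
Proof. by case/andP => /eqP-> /eqP->. Qed.

Lemma at_pos_interior s i x : 0 < i < N -> at_pos s i x ->
  exists j : 'I_N.-1, x = inr (s, j) /\ i = j.+1.
Proof.
case: x => [v|[s' j]] /= iN; last by case/andP => /eqP-> /eqP->; exists j.
by case/orP => /andP[/eqP E _]; lia.
Qed.

Hypothesis N_gt0 : 0 < N.

Lemma at_pos_fun s i x y : at_pos s i x -> at_pos s i y -> x = y.
Proof.
case: x y => [u|[s1 j1]] [v|[s2 j2]] /=.
- case/orP => /andP[/eqP-> /eqP Eu]; case/orP => /andP[/eqP iE /eqP Ev]; try lia.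
  + by move: Ev; rewrite Eu => -[->].
  + by move: Ev; rewrite Eu => -[->].
- by case/orP => /andP[/eqP-> _] /andP[_ /eqP]; have := ltn_ord j2; lia.
- by case/andP => _ /eqP->; case/orP => /andP[/eqP]; have := ltn_ord j1; lia.
case/andP => /eqP-> /eqP-> /andP[/eqP-> /eqP[E]].
by congr (inr (_, _)); apply/val_inj.
Qed.

(** The vertex has position [j.+1], so its neighbours occupy positions [j] and [j.+2] of the same
    path, each held by at most one vertex. *)
Lemma subdiv_edge_deg s j :
  #|[set y : V | subdiv_edge (inr (s, j) : V) y]| <= 2.
Proof.
pose A i := [set y : V | at_pos s i y].
have A1 i : #|A i| <= 1.
  by apply/card_le1_eqP => x y; rewrite !inE => xi yi; exact: at_pos_fun yi xi.
apply: (@leq_trans #|A j :|: A j.+2|); last first.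
  by rewrite (leq_trans (leq_card_setU _ _)) // (leq_add (A1 _) (A1 _)).
apply/subset_leq_card/fintype.subsetP => y; rewrite !inE.
case/orP => [|/existsP[s' /existsP[m]]]; first by case: y.
case/orP => /andP[].
  by move=> /at_pos_inner[-> E]; rewrite -E => ->; rewrite orbT.
by move=> yi /at_pos_inner[E [<-]]; rewrite -E yi.
Qed.
End Positions.

(** * [H_t] as an induced subgraph of a longer subdivision *)

Section TruncatedSubdivision.
Local Open Scope nat_scope.
Variables (G : sgraph) (S : {set {set G}}) (N t : nat).
Hypothesis t_gt0 : 0 < t.
Local Notation V := (subdiv_vertex S N).
Local Notation W := (subdiv_vertex S (2 * t).+1).

(** As [t > 0], positions [t] and [t.+1] are interior, so a middle edge lies on one path only and at
    one position only; deleting it removes just the index [t]. *)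
Lemma cut_edgeE (x y : W) : @cut_edge G S t x y = kept_edge x y ||
  [exists s, [exists i : 'I_(2 * t).+1, (i != t :> nat) && path_edge s i x y]].
Proof.
apply/andP/orP => [[/orP[|/existsP[s /existsP[m p]]] cut]|].
- by left.
- right; apply/existsP; exists s; apply/existsP; exists m; rewrite p andbT.
  by apply: contraNN cut => /eqP mt; apply/existsP; exists s; rewrite -[X in path_edge s X]mt.
case=> [kxy|/existsP[s /existsP[m /andP[it p]]]].
  split; first by rewrite /sedge /= /subdiv_edge kxy.
  apply/existsP => -[s]; case: x y kxy => [u|p] [v|q] // _.
  by rewrite /path_edge /= => /orP[] /andP[/orP[] /andP[/eqP]]; lia.
split.
  by apply/orP; right; apply/existsP; exists s; apply/existsP; exists m.
apply/existsP => -[s']; have tt : 0 < t < (2 * t).+1 by lia.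
have tt1 : 0 < t.+1 < (2 * t).+1 by lia.
case/orP => /andP[/(at_pos_interior tt)[j [xE jE]] /(at_pos_interior tt1)[j' [yE jE']]];
  rewrite xE yE in p;
  by case/orP: p => /andP[/at_pos_inner[_ ?] /at_pos_inner[_ ?]]; move/eqP: it; lia.
Qed.

Hypothesis tN : (2 * t).+1 < N.

(* Keeps the first half of each path in place and slides the second half to
   the far end of a path of length [N]. *)
Definition shift i := if i <= t then i else i + (N - (2 * t).+1).

Lemma shift_subproof (j : 'I_(2 * t)) : (shift j.+1).-1 < N.-1.
Proof. by rewrite /shift; have := ltn_ord j; case: ifP; lia. Qed.

Definition shift_vertex (x : W) : V :=
  match x with
  | inl v => inl v
  | inr (s, j) => inr (s, Ordinal (shift_subproof j))
  end.

Lemma at_pos_shift s i x : i <= (2 * t).+1 ->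
  at_pos s (shift i) (shift_vertex x) = at_pos s i x.
Proof.
rewrite /shift => it; case: x => [v|[s' j]] /=; have := tN.
  by move=> h; congr (_ && _ || _ && _); case: ifP; lia.
move=> h; congr (_ && _); rewrite /shift; have := ltn_ord j.
by do 2!case: ifP; lia.
Qed.

Lemma at_pos_shift_ex s p x : at_pos s p (shift_vertex x) ->
  exists2 i, i <= (2 * t).+1 & p = shift i.
Proof.
have := tN; case: x => [v|[s' j]] /= h.
  case/orP => /andP[/eqP-> _]; first by exists 0.
  by exists (2 * t).+1 => //; rewrite /shift; case: ifP; lia.
case/andP => _ /eqP->; exists j.+1; first by have := ltn_ord j; lia.
by rewrite /shift; case: ifP; lia.
Qed.

Lemma shift_vertex_inj : injective shift_vertex.
Proof.
case=> [u|[s j]] [v|[s' j']] //= [->] // E.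
congr (inr (_, _)); apply/val_inj => /=; move: E; rewrite /shift; have := tN.
by do 2!case: ifP; lia.
Qed.

(** [shift] keeps consecutive positions consecutive except [t] and [t.+1], which the strict
    inequality [tN] drives apart. This break is the deleted middle edge. *)
Lemma shift_vertex_edge x y :
  subdiv_edge (shift_vertex x) (shift_vertex y) = @cut_edge G S t x y.
Proof.
rewrite cut_edgeE /subdiv_edge; congr (_ || _).
  by case: x y => [u|[s j]] [v|[s' j']].
have half s i x' y' : at_pos s i (shift_vertex x') ->
    at_pos s i.+1 (shift_vertex y') ->
    exists2 a : 'I_(2 * t).+1, a != t :> nat & at_pos s a x' && at_pos s a.+1 y'.
  move=> px py; have [a at1 iE] := at_pos_shift_ex px.
  have [b bt1 iE'] := at_pos_shift_ex py.
  rewrite iE' at_pos_shift // in py; rewrite iE at_pos_shift // in px.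
  have [bE aN] : b = a.+1 /\ a <> t.
    by move: iE'; rewrite iE /shift; have := tN; do 2!case: ifP; lia.
  have a2 : a < (2 * t).+1 by lia.
  by exists (Ordinal a2); [exact/eqP | rewrite /= px -bE py].
apply/existsP/existsP => -[s /existsP[m]].
  case/orP => /andP[p q]; have [a aN r] := half _ _ _ _ p q; exists s;
    by apply/existsP; exists a; rewrite aN /path_edge r ?orbT.
case/andP => it p; have iN : shift m < N.
  by have := ltn_ord m; have := tN; rewrite /shift; case: ifP; lia.
have iS : shift m.+1 = (shift m).+1.
  by move/eqP: it; rewrite /shift; do 2!case: ifP; lia.
exists s; apply/existsP; exists (Ordinal iN).
by rewrite /path_edge /= -iS !at_pos_shift //; have := ltn_ord m; lia.
Qed.

Lemma shift_vertex_dist x : core_dist (shift_vertex x) <= t.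
Proof.
case: x => [//|[s j]] /=; have := ltn_ord j; have := tN; rewrite /shift.
by case: ifP; lia.
Qed.

Lemma shift_vertex_codom y : core_dist y <= t -> y \in codom shift_vertex.
Proof.
case: y => [v|[s p]] /=; first by move=> _; apply/codomP; exists (inl v).
move=> pt; have pN := ltn_ord p; have h := tN.
(* The inverse of [shift], written for indices, which are one less than positions. *)
pose i := if p.+1 <= t then p : nat else p - (N - (2 * t).+1).
have it : i < 2 * t by rewrite /i; case: ifP; lia.
apply/codomP; exists (inr (s, Ordinal it)) => /=.
congr (inr (_, _)); apply/val_inj; rewrite /= /shift /i.
by do 2!case: ifP; lia.
Qed.
End TruncatedSubdivision.

(** * Two-sided comparison with [H_t] *)

Section Comparison.
Variables (R : rcfType) (G : sgraph) (S : {set {set G}}) (N t : nat).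
Hypotheses (t_gt0 : (0 < t)%N) (tN : ((2 * t).+1 < N)%N).
Local Notation V := (subdiv_vertex S N).

Variable e : rel V.
Hypotheses (e_sym : symmetric e) (e_irr : irreflexive e).
Hypothesis e_sub : subrel e (@subdiv_edge G S N).
Hypothesis e_core : forall x y : V, (core_dist x <= t)%N -> (core_dist y <= t)%N ->
  subdiv_edge x y -> e x y.
(** Edges are prescribed only within distance [t] of [G], so [X] may be [G_N(S)] or, for [N = 2n+1]
    and [t < n], [H_n(S)]. *)
Let X := SGraph e_sym e_irr.
Let phi : cut_subdiv S t -> X := @shift_vertex G S N t t_gt0 tN.

Let phi_inj : injective phi.
Proof. exact: shift_vertex_inj. Qed.

Let phi_edge y z : sedge (phi y) (phi z) = sedge y z.
Proof.
have dphi := shift_vertex_dist t_gt0 tN.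
rewrite -[RHS](shift_vertex_edge t_gt0 tN y z).
by apply/idP/idP => [/e_sub //|]; apply: e_core.
Qed.

Lemma lambda_cut_le k : (0 < k <= #|cut_subdiv S t|)%N ->
  lambda R k (cut_subdiv S t) <= lambda R k X.
Proof. exact: lambda_induced phi_inj phi_edge k. Qed.

(** Vertices off [G] have at most two neighbours, whence [c = 2]; [chi] drops by at most [1 / t]
    along an edge, whence the error [2 / t]. *)
Lemma lambda_le_cut k : (0 < k <= #|cut_subdiv S t|)%N ->
  lambda R k X <= Num.max (lambda R k (cut_subdiv S t)) 2 + 2 / t%:R.
Proof.
have t0 : 0 < t%:R :> R by rewrite ltr0n.
(* [1] at distances [0] and [1] by truncated subtraction, so that the vertices
   of [G], whose degree is not bounded by 2, contribute no error. *)
pose chi (x : X) : R := (t - (core_dist x).-1)%:R / t%:R.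
have chi01 x : 0 <= chi x <= 1.
  by rewrite divr_ge0 // ler_pdivrMr // mul1r ler_nat leq_subr.
have chi1 x : (core_dist x <= 1)%N -> chi x = 1.
  move=> x1; rewrite /chi; have -> : (core_dist x).-1 = 0%N by lia.
  by rewrite subn0 divff // lt0r_neq0.
apply: (@lambda_cutoff R X _ phi phi_inj phi_edge chi) => // [x|x].
  move=> x0; apply: (shift_vertex_codom t_gt0); rewrite leqNgt; apply: contraNN x0.
  move=> tx; rewrite /chi; have -> : (t - (core_dist x).-1 = 0)%N by lia.
  by rewrite mul0r.
have [x1|x1] := leqP (core_dist x) 0.
  rewrite big1 => [|y /e_sub/subdiv_edge_dist xy].
    by rewrite chi1 ?expr1n ?subrr ?mulr0 ?add0r ?divr_ge0 //; lia.
  by rewrite !chi1 ?mulr1 ?subrr //; lia.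
(* A bound for one term: [1 - p q = 1 - p ^+ 2 + p (p - q)], where [p (p - q) <= 1 / t]. *)
pose B := 1 - chi x ^+ 2 + t%:R^-1.
have /andP[x0 xle1] := chi01 x.
have B0 : 0 <= B by rewrite addr_ge0 ?invr_ge0 // subr_ge0 expr_le1.
apply: (@le_trans _ _ (\sum_(y | sedge x y) B)).
  apply: ler_sum => y /e_sub/subdiv_edge_dist xy.
  have lip : chi x - chi y <= t%:R^-1.
    rewrite /chi -mulrBl -[leRHS]mul1r ler_pM2r ?invr_gt0 // lerBlDl natr1 ler_nat.
    lia.
  have ti : 0 <= t%:R^-1 :> R by rewrite invr_ge0.
  have := ler_wpM2l x0 lip; have := ler_wpM2r ti xle1; rewrite /B.
  move: (chi x) (chi y) (t%:R^-1) => p q r; lra.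
have deg : (#|[pred y | @sedge X x y]| <= 2)%N.
  case: x x1 {x0 xle1 B0 B} => [//|[s j]] _.
  apply: leq_trans (subdiv_edge_deg (leq_ltn_trans (leq0n _) tN) s j).
  by apply/subset_leq_card/fintype.subsetP => y; rewrite !inE; exact: e_sub.
rewrite sumr_const -[leLHS]mulr_natr; have -> : 2 * (1 - chi x ^+ 2) + 2 / t%:R = B * 2%:R.
  by rewrite /B; field; exact: lt0r_neq0.
by rewrite ler_wpM2l // ler_nat.
Qed.

(** With no edge subdivided, [phi] is an isomorphism. *)
Lemma lambda_cut_no_edge k : S = finset.set0 -> (0 < k)%N ->
  lambda R k X = lambda R k (cut_subdiv S t).
Proof.
move=> S0 k0.
have codom_phi x : x \in codom phi.
  case: x => [v|[s j]]; first by apply/codomP; exists (inl v).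
  by case: s => s sS; have := sS; rewrite {1}S0 inE.
have cardX : #|X| = #|cut_subdiv S t|.
  by rewrite -(card_codom phi_inj); apply/esym/eq_card => x; rewrite codom_phi.
(* For [k] beyond the number of vertices both sides are the default 0. *)
have [kY|kY] := leqP k #|cut_subdiv S t|; last first.
  rewrite /lambda !nth_default // size_spectrum_adjacency ?cardX;
  by rewrite -ltnS prednK.
have kY' : (0 < k <= #|cut_subdiv S t|)%N by rewrite k0.
apply/eqP; rewrite eq_le lambda_cut_le // andbT.
rewrite -[leRHS]addr0 -[X in X + 0]maxxx.
apply: (@lambda_cutoff R X _ phi phi_inj phi_edge (fun=> 1)) => // x.
  by rewrite lexx ler01.
by rewrite big1 ?expr1n ?mulr1 ?subrr ?mulr0 ?addr0.
Qed.
End Comparison.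

(** * Lower bound from disjoint induced paths *)

(** The test vectors are the indicators of [k.+1] disjoint paths with no edges between them. Each
    has square norm [L.+1] and adjacency form [2 L], as its [L] edges count twice. *)
Lemma lambda_ge_blocks (R : rcfType) (Y : sgraph) k L (x : 'I_k.+1 -> 'I_L.+1 -> Y) :
  (forall i j i' j', x i j = x i' j' -> i = i' /\ j = j') ->
  (forall i j i' j', sedge (x i j) (x i' j') =
     (i == i') && ((j.+1 == j' :> nat) || (j'.+1 == j :> nat))) ->
  (k < #|Y|)%N /\ 2 - 2 / L.+1%:R <= lambda R k.+1 Y.
Proof.
move=> x_inj x_edge.
have kY : (k < #|Y|)%N.
  have x0_inj : injective (fun i => x i ord0) by move=> i i' /x_inj[].
  by have := leq_card _ x0_inj; rewrite card_ord.
split=> //; pose A := adjacency R Y.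
pose C : 'M[R]_(k.+1, #|Y|) :=
  \matrix_(i, p) \sum_j (p == enum_rank (x i j))%:R.
have CF (F : 'I_#|Y| -> R) i : \sum_p C i p * F p = \sum_j F (enum_rank (x i j)).
  under eq_bigr do rewrite mxE mulr_suml.
  rewrite exchange_big; apply: eq_bigr => j _.
  rewrite (bigD1 (enum_rank (x i j))) //= eqxx mul1r big1 ?addr0 // => p pj.
  by rewrite (negPf pj) mul0r.
have CE i i' j : C i' (enum_rank (x i j)) = (i == i')%:R.
  rewrite mxE; have [<-|ii'] := eqVneq i i'.
    rewrite (bigD1 j) //= eqxx big1 ?addr0 // => j' jj'.
    rewrite (inj_eq enum_rank_inj); case: eqP => // /x_inj[_ E].
    by rewrite E eqxx in jj'.
  rewrite big1 // => j' _; rewrite (inj_eq enum_rank_inj).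
  by case: eqP => // /x_inj[E]; rewrite E eqxx in ii'.
have CC : C *m C^T = (L.+1%:R)%:M.
  apply/matrixP => i i'; rewrite mxE [RHS]mxE.
  under eq_bigr do rewrite [_^T _ _]mxE.
  rewrite (CF (C i')); under eq_bigr do rewrite CE.
  by rewrite sumr_const card_ord; case: eqP; rewrite ?mul0rn.
have CAC : C *m A *m C^T = (2 * L%:R)%:M.
  apply/matrixP => i i'; rewrite mxE [RHS]mxE.
  under eq_bigr do rewrite [_^T _ _]mxE mulrC.
  rewrite (CF ((C *m A) i)).
  have AE j' : (C *m A) i (enum_rank (x i' j')) =
      \sum_(j < L.+1) ((i == i') && ((j.+1 == j' :> nat) || (j'.+1 == j :> nat)))%:R.
    rewrite mxE (CF (fun p => A p _)); apply: eq_bigr => j _.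
    by rewrite mxE !enum_rankK x_edge.
  under eq_bigr do rewrite AE.
  have [_|_] := eqVneq i i'; last by rewrite big1 // => j _; rewrite big1.
  have succ : \sum_(j < L.+1) \sum_(j' < L.+1) (j.+1 == j' :> nat)%:R = L%:R :> R.
    rewrite big_ord_recr /= [X in _ + X]big1 ?addr0 => [|j' _]; last first.
      by rewrite gtn_eqF.
    rewrite -[in RHS](card_ord L) -sumr_const; apply: eq_bigr => j _.
    have jL : (j.+1 < L.+1)%N by rewrite ltnS.
    rewrite (bigD1 (Ordinal jL)) //= eqxx big1 ?addr0 // => j' /eqP jj'.
    by case: eqP => // E; case: jj'; apply/val_inj.
  have pred : \sum_(j < L.+1) \sum_(j' < L.+1) (j'.+1 == j :> nat)%:R = L%:R :> R.
    by rewrite exchange_big.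
  rewrite mulr1n mulr_natl mulr2n -{1}succ -pred -big_split.
  apply: eq_bigr => j _; rewrite -big_split; apply: eq_bigr => j' _ /=.
  (* The two adjacencies exclude each other, so the indicator of the disjunction is a sum of
     indicators. *)
  have [E1|_] := eqVneq j.+1 (j' : nat); have [E2|_] := eqVneq j'.+1 (j : nat);
    rewrite ?addr0 ?add0r // ?E1 ?E2; lia.
have L0 : 0 < L.+1%:R :> R by rewrite ltr0n.
have -> : 2 - 2 / L.+1%:R = 2 * L%:R / L.+1%:R :> R.
  by rewrite -natr1 in L0 *; field; exact: lt0r_neq0.
exact: (le_spectrum_of_test (adjacency_sym R Y) kY L0 CC CAC).
Qed.

(** Indices below [t] have positions up to [t], short of the cut between [t] and [t.+1]. *)
Lemma cut_edge_inner (G : sgraph) (S : {set {set G}}) t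
    (s : {s : {set G} | s \in S}) (p q : 'I_(2 * t)) :
    (p < t)%N -> (q < t)%N ->
  @cut_edge G S t (inr (s, p)) (inr (s, q)) =
  (p.+1 == q :> nat) || (q.+1 == p :> nat).
Proof.
move=> pt qt; have t0 : (0 < t)%N by lia.
rewrite cut_edgeE //=; apply/existsP/idP => [[s' /existsP[m /andP[_]]]|].
  by rewrite /path_edge /= => /orP[] /andP[/andP[_ /eqP->] /andP[_]];
    rewrite eqSS => -> //; rewrite orbT.
have mt (a : 'I_(2 * t)) : (a.+1 < (2 * t).+1)%N by rewrite ltnS.
case/orP => /eqP E; exists s; apply/existsP.
  exists (Ordinal (mt p)); rewrite /path_edge /= !eqxx E !eqxx /= andbT; lia.
exists (Ordinal (mt q)); rewrite /path_edge /= !eqxx E !eqxx /= orbT andbT; lia.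
Qed.

(** Blocks of [L.+1] vertices are laid along the first half of one path with stride [L.+2]; the
    vertex skipped after each block separates it from the next. *)
Lemma lambda_cut_ge (R : rcfType) (G : sgraph) (S : {set {set G}}) k L t :
    S != finset.set0 -> (k.+1 * L.+2 <= t)%N ->
  (k < #|cut_subdiv S t|)%N /\
  2 - 2 / L.+1%:R <= lambda R k.+1 (cut_subdiv S t).
Proof.
case/set0Pn => s0 s0S kt; pose s : {s : {set G} | s \in S} := exist _ s0 s0S.
have lt_t (i : 'I_k.+1) (j : 'I_L.+1) : (i * L.+2 + j < t)%N.
  have := ltn_ord i; have := ltn_ord j; nia.
have lt_2t (i : 'I_k.+1) (j : 'I_L.+1) : (i * L.+2 + j < 2 * t)%N.
  by have := lt_t i j; lia.
have split_eq (i i' a b : nat) : (a < L.+2)%N -> (b < L.+2)%N ->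
    (i * L.+2 + a = i' * L.+2 + b)%N -> i = i' /\ a = b.
  move=> aL bL E; have ii : i = i'.
    have := congr1 (divn^~ L.+2) E.
    by rewrite /= !divnMDl // !divn_small // !addn0.
  by split=> //; move: E; rewrite ii => /addnI.
pose x i j : cut_subdiv S t := inr (s, Ordinal (lt_2t i j)).
apply: (@lambda_ge_blocks R _ k L x) => i j i' j'.
  case=> /split_eq[]; rewrite ?(ltn_trans (ltn_ord _)) // => ii jj.
  by split; apply/val_inj.
rewrite [LHS]cut_edge_inner ?lt_t //=.
(* [j.+1] is still a remainder modulo [L.+2], so no step leads from one block into another. *)
have jL : (j.+1 < L.+2)%N := ltn_ord j; have jL' : (j'.+1 < L.+2)%N := ltn_ord j'.
apply/idP/idP.
  rewrite -!addnS => /orP[] /eqP/split_eq[]; rewrite ?(ltnW jL) ?(ltnW jL') // => E <-;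
  by rewrite -(inj_eq val_inj) /= E !eqxx ?orbT.
by case/andP => /eqP -> /orP[] /eqP <-; rewrite addnS eqxx ?orbT.
Qed.

(** * Convergence of both sequences *)

(** The value [v] is [lambda_k(H_t)] for one fixed [t]. A common [v] gives the Cauchy property and
    the equality of the limits together. *)
Lemma lambda_approx (R : realType) (G : sgraph) (S : {set {set G}}) k (e : R) :
    (0 < k)%N -> 0 < e ->
  exists (T : nat) (v : R), forall n, (T <= n)%N ->
    `|lambda R k (subdiv S n.+1) - v| <= e /\
    `|lambda R k (cut_subdiv S n.+1) - v| <= e.
Proof.
move=> k0 e0; have cut_sub n : subrel (@cut_edge G S n) (@subdiv_edge G S (2 * n).+1).
  by move=> x y /andP[].
(* The edges deleted in [H_n] join vertices at distance [n] from [G], beyond [t]. *)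
have cut_core n t : (t < n)%N -> forall x y : subdiv_vertex S (2 * n).+1,
    (core_dist x <= t)%N -> (core_dist y <= t)%N -> subdiv_edge x y -> cut_edge x y.
  move=> tn x y xt yt xy; rewrite /cut_edge /sedge /= xy; apply/existsP => -[s].
  case/orP => /andP[/at_pos_dist E _]; [move: xt|move: yt]; rewrite E; lia.
have [S0|S0] := eqVneq S finset.set0.
  exists 4, (lambda R k (cut_subdiv S 1)) => n n4.
  have Nn : ((2 * 1).+1 < n.+1)%N by lia.
  have N2n : ((2 * 1).+1 < (2 * n.+1).+1)%N by lia.
  have n1 : (1 < n.+1)%N by lia.
  have -> : lambda R k (subdiv S n.+1) = lambda R k (cut_subdiv S 1).
    by apply: (lambda_cut_no_edge _ (ltn0Sn 0) Nn (e := @subdiv_edge G S n.+1)).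
  have -> : lambda R k (cut_subdiv S n.+1) = lambda R k (cut_subdiv S 1).
    by apply: (lambda_cut_no_edge _ (ltn0Sn 0) N2n (e := @cut_edge G S n.+1)) => //;
    [exact: cut_sub | exact: cut_core n1].
  by rewrite subrr normr0 ltW.
(* Two errors of at most [2 / L.+1] must fit into [e]: the gap [max(v, 2) - v] and the cutoff error
   [2 / t]. *)
have [L eL] : exists L : nat, 4 / L.+1%:R <= e.
  exists (Num.truncn (4 / e)); rewrite ler_pdivrMr ?ltr0n // mulrC -ler_pdivrMr //.
  by rewrite ltW // truncnS_gt.
case: k k0 => // k _; pose t := (k.+1 * L.+2)%N.
have [kY vL] := lambda_cut_ge R S0 (leqnn t).
have t0 : (0 < t)%N by rewrite muln_gt0.
have tL : 2 / t%:R <= 2 / L.+1%:R :> R.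
  by rewrite ler_pM2l // lef_pV2 ?posrE ?ltr0n // ler_nat /t; nia.
set v := lambda R k.+1 (cut_subdiv S t) in vL.
have bound (x : R) : v <= x -> x <= Num.max v 2 + 2 / t%:R -> `|x - v| <= e.
  move=> vx xv; rewrite ger0_norm ?subr_ge0 // lerBlDl; apply: (le_trans xv).
  have : 0 <= L.+1%:R^-1 :> R by rewrite invr_ge0.
  move: (t%:R^-1) (L.+1%:R^-1) tL vL eL => p q pq vq eq q0.
  by have [_|_] := leP v 2; lra.
exists (2 * t).+1, v => n tn.
have Nn : ((2 * t).+1 < n.+1)%N by [].
have N2n : ((2 * t).+1 < (2 * n.+1).+1)%N by lia.
have n1 : (t < n.+1)%N by lia.
split; apply: bound.
- by apply: (lambda_cut_le _ t0 Nn (e := @subdiv_edge G S n.+1)).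
- by apply: (lambda_le_cut _ t0 Nn (e := @subdiv_edge G S n.+1)).
- by apply: (lambda_cut_le _ t0 N2n (e := @cut_edge G S n.+1)) => //;
    [exact: cut_sub | exact: cut_core n1].
- by apply: (lambda_le_cut _ t0 N2n (e := @cut_edge G S n.+1)) => //;
    [exact: cut_sub | exact: cut_core n1].
Qed.

Unset Implicit Arguments.
Local Open Scope classical_set_scope.

Theorem theorem1p1 (R : realType) (G : sgraph) (S : {set {set G}})
    (hS : S \subset edges G) (k : nat) (hk : (0 < k)%N) :
  [/\ cauchy ((fun t : nat => lambda R k (subdiv S t.+1)) @ \oo),
      cauchy ((fun t : nat => lambda R k (cut_subdiv S t.+1)) @ \oo) &
      limn (fun t : nat => lambda R k (subdiv S t.+1)) =
      limn (fun t : nat => lambda R k (cut_subdiv S t.+1))].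
Proof.
set u := fun t => lambda R k (subdiv S t.+1).
set w := fun t => lambda R k (cut_subdiv S t.+1).
have approx e : 0 < e -> exists v : R,
    (\forall n \near \oo, `|v - u n| < e) /\ (\forall n \near \oo, `|v - w n| < e).
  move=> e0; have e2 : 0 < e / 2 by rewrite divr_gt0.
  have [T [v Tv]] := lambda_approx S hk e2.
  exists v; split; near=> n.
    have [|uv _] := Tv n; first by near: n; exact: nbhs_infty_ge.
    by rewrite distrC (le_lt_trans uv) // ltr_pdivrMr // mulr_natr mulr2n ltrDl.
  have [|_ wv] := Tv n; first by near: n; exact: nbhs_infty_ge.
  by rewrite distrC (le_lt_trans wv) // ltr_pdivrMr // mulr_natr mulr2n ltrDl.
have cauchy_u : cauchy (u @ \oo).
  by apply: cauchy_exP => e /approx[v [uv _]]; exists v.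
have cauchy_w : cauchy (w @ \oo).
  by apply: cauchy_exP => e /approx[v [_ wv]]; exists v.
split=> //.
(* By completeness both sequences converge, so each [limn] is a genuine limit. *)
have /cauchy_cvgP cvg_u := cauchy_u; have /cauchy_cvgP cvg_w := cauchy_w.
have u_sub_w : u \- w @ \oo --> 0.
  apply/cvgr0Pnorm_lt => e e0; have e2 : 0 < e / 2 by rewrite divr_gt0.
  have [v [uv wv]] := approx _ e2; near=> n.
  have -> : (u \- w) n = (v - w n) - (v - u n) by rewrite /=; ring.
  rewrite (le_lt_trans (ler_normB _ _)) // [ltRHS](splitr e).
  by rewrite ltrD //; near: n.
apply/eqP; rewrite -subr_eq0 -limB //; apply/eqP.
exact: cvg_lim u_sub_w.
Unshelve. all: by end_near. Qed.
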